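(* Let $n\ge 2$ be an integer and let $p$ be a prime with $p>n+1$. Then $$\sum_{\substack{k_1+k_2+\cdots+k_n=p\\ k_i>0,\ 1\le i\le n}}\frac{(-1)^{k_1}\left(\left(\frac{k_1+1}{3}\right)-\left(\frac{k_1-1}{3}\right)\right)}{k_1k_2\cdots k_n}\equiv \begin{cases} \displaystyle -(n-2)!\sum_{r=0}^{p-n}\binom{p-n+1}{r}\frac{(3^{n+r-2}-1)(2^{n+r-2}-1)\,B_r\,B_{p-n-r+1}}{(n+r-1)6^{n+r-2}}, & \text{if } n \text{ is even},\\[3mm] -(n-1)!\left(1-\dfrac{(3^{n-1}-1)(2^{n-1}-1)}{2n\,6^{n-1}}\right)B_{p-n}, & \text{if } n \text{ is odd}, \end{cases}\pmod p.$$
   Context: The sum runs over all ordered $n$-tuples $(k_1,\dots,k_n)$ of positive integers with $k_1+\cdots+k_n=p$. For an integer $a$, $\left(\frac{a}{3}\right)$ is the Legendre symbol modulo $3$: it equals $0$ if $3\mid a$, $1$ if $a\equiv 1\pmod 3$, and $-1$ if $a\equiv 2\pmod 3$. The Bernoulli numbers $B_m$ are defined by $\frac{z}{e^z-1}=\sum_{m\ge 0}B_m\frac{z^m}{m!}$ (so $B_0=1$, $B_1=-1/2$). For rational numbers $a,b$, the congruence $a\equiv b\pmod p$ means that $a-b$ is $p$ times a rational number whose denominator is not divisible by $p$. *)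

(* Defs.v *)
From mathcomp Require Import all_boot all_order all_algebra.
Set Implicit Arguments.
Unset Strict Implicit.
Unset Printing Implicit Defensive.
Import Order.TTheory GRing.Theory Num.Theory.
Local Open Scope ring_scope.

Definition legendre3 (a : int) : int :=
  if (3 %| a)%Z then 0 else if (a == 1 %[mod 3])%Z then 1 else -1.

Definition eqmod_rat (p : nat) (a b : rat) : Prop :=
  exists2 c : rat, a - b = p%:R * c & ~~ (p%:Z %| denq c)%Z.

(* A sequence f : nat -> rat stands for the formal power series
   \sum_m (f m) z^m. *)
Definition fps_mul (f g : nat -> rat) (m : nat) : rat :=
  \sum_(i < m.+1) f i * g (m - i)%N.

(* [:: h 0; ...; h (n - 1)], where h is the multiplicative inverse of f,
   assuming f 0 != 0. *)
Fixpoint fps_inv_coefs (f : nat -> rat) (n : nat) : seq rat :=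
  if n is m.+1 then
    let s := fps_inv_coefs f m in
    rcons s ((f 0%N)^-1 *
             ((m == 0%N)%:R - \sum_(i < m) s`_i * f (m - i)%N))
  else [::].

Definition fps_inv (f : nat -> rat) (m : nat) : rat :=
  (fps_inv_coefs f m.+1)`_m.

Definition expm1 (m : nat) : rat := if m is 0 then 0 else (m`!)%:R^-1.

(* z / (e^z - 1) is the inverse of (e^z - 1) / z, whose constant term is 1. *)
Definition bernoulli (m : nat) : rat :=
  (m`!)%:R * fps_inv (fun j => expm1 j.+1) m.

Lemma size_fps_inv_coefs f n : size (fps_inv_coefs f n) = n.
Proof. by elim: n => //= n IHn; rewrite size_rcons IHn. Qed.

Lemma nth_fps_inv_coefs f n i :
  (i < n)%N -> (fps_inv_coefs f n)`_i = fps_inv f i.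
Proof.
elim: n => // n IHn; rewrite ltnS leq_eqVlt => /orP[/eqP-> //|lt_in].
by rewrite /= nth_rcons size_fps_inv_coefs lt_in IHn.
Qed.

Lemma fps_mulVf f m : f 0%N != 0 -> fps_mul (fps_inv f) f m = (m == 0%N)%:R.
Proof.
move=> f0; rewrite /fps_mul big_ord_recr /= subnn.
rewrite {2}/fps_inv /= nth_rcons size_fps_inv_coefs ltnn eqxx.
rewrite mulrAC mulVf // mul1r.
under [in X in _ + (_ - X)]eq_bigr => i _ do rewrite nth_fps_inv_coefs //.
by rewrite addrC subrK.
Qed.

(* (\sum_m B_m z^m / m!) (e^z - 1) = z *)
Lemma bernoulli_egf m :
  fps_mul (fun j => bernoulli j / (j`!)%:R) expm1 m = (m == 1%N)%:R.
Proof.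
case: m => [|m]; first by rewrite /fps_mul big_ord1 mulr0.
rewrite /fps_mul big_ord_recr /= subnn mulr0 addr0 eqSS.
rewrite -(@fps_mulVf (fun j => expm1 j.+1)) ?invr_eq0 ?oner_eq0 //.
apply: eq_bigr => i _; rewrite subSn -1?ltnS //; congr (_ * _).
by rewrite /bernoulli mulrC mulKf // pnatr_eq0 -lt0n fact_gt0.
Qed.

(* k_1 is head ord0 k; the default value ord0 only matters when n = 0.  The
   bound 'I_p.+1 loses nothing, since positive k_i with sum p are at most p. *)
Definition composition_sum (n p : nat) : rat :=
  \sum_(k : n.-tuple 'I_p.+1 |
         (\sum_(i < n) tnth k i == p)%N && [forall i, 0 < tnth k i]%N)
    (-1) ^+ head ord0 k *
    (legendre3 ((head ord0 k : nat)%:Z + 1)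
     - legendre3 ((head ord0 k : nat)%:Z - 1))%:~R
    / \prod_(i < n) (tnth k i : nat)%:R.

(* Main.v *)
(** Let [c i = (-1)^i (((i+1)/3) - ((i-1)/3))]; this is the trace of the [i]-th
    power of a primitive 6th root of unity, so the sum is the coefficient of
    [z^p] in [L l^(n-1)], where [l = sum_k z^k / k] and [L = sum_k c_k z^k / k].

    In characteristic [p] one has [(1 - z) l' = 1 - z^(p-1)] for [l] truncated
    below degree [p], which gives a recurrence solved by
    [coef_(p-i) l^k = - k! sum_(1<=j<=i) (-1)^(j-1) C(i-1, j-1) / j^k].
    Summing [c_i C(i-1, j-1)] over [1 <= i <= p] telescopes because
    [c_(i+2) = c_(i+1) - c_i], and the sum is dual to
    [(n-1)! sum_(1<=j<=i<p) d_i / (i j^(n-1))] with [d_i = c_(i+p) + 1].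
    As [j^-(n-1) = j^(p-n)], Faulhaber's formula reduces everything to the sums
    [sum_i d_i i^(m-1)].  Finally, [sum_(k<6p) c_k k^m] modulo [p^2] is computed
    in two ways: cutting the range into six blocks of length [p] gives
    [- 6 p m sum_(i<p) c_(i+p) i^(m-1)], while
    [c_i = 6 [6|i] - 3 [3|i] - 2 [2|i] + 1] and Faulhaber's formula give
    [6 p (2^m - 1) (3^m - 1) B_m]. *)
Require Import Defs.
From mathcomp Require Import all_boot all_order all_algebra.
From mathcomp Require Import zify ring.
Import Order.TTheory GRing.Theory Num.Theory.
Set Implicit Arguments.
Unset Strict Implicit.
Unset Printing Implicit Defensive.
Local Open Scope ring_scope.

(** * Reduction of rationals *)

Section Reduction.
Variable F : fieldType.

(** Reduction is a partial map, hence a relation. The fraction need not be in lowest terms, so sums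
    and products require no gcd. *)
Definition reduces (x : rat) (y : F) : Prop :=
  exists a b : int,
    [/\ b%:~R != 0 :> F, x = a%:~R / b%:~R & y = a%:~R / b%:~R].

Lemma intr_rat_neq0 (b : int) : b%:~R != 0 :> F -> b%:~R != 0 :> rat.
Proof. by apply: contraNneq => /eqP; rewrite intr_eq0 => /eqP->. Qed.

Lemma reduces_int (a : int) : reduces a%:~R a%:~R.
Proof. by exists a, 1; rewrite !mulr1z !divr1 oner_neq0. Qed.

Lemma reduces_nat (a : nat) : reduces a%:R a%:R.
Proof. exact: (reduces_int a%:Z). Qed.

Lemma reducesD x y x' y' :
  reduces x x' -> reduces y y' -> reduces (x + y) (x' + y').
Proof.
move=> [a [b [b0 -> ->]]] [c [d [d0 -> ->]]]; exists (a * d + c * b), (b * d).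
have b0' := intr_rat_neq0 b0; have d0' := intr_rat_neq0 d0.
rewrite !rmorphD /= !rmorphM /= mulf_neq0 //; split=> //.
  by rewrite addf_div.
by rewrite addf_div.
Qed.

Lemma reducesM x y x' y' :
  reduces x x' -> reduces y y' -> reduces (x * y) (x' * y').
Proof.
move=> [a [b [b0 -> ->]]] [c [d [d0 -> ->]]]; exists (a * c), (b * d).
by rewrite !rmorphM /= mulf_neq0 // !mulf_div.
Qed.

Lemma reducesN x x' : reduces x x' -> reduces (- x) (- x').
Proof.
move=> [a [b [b0 -> ->]]]; exists (- a), b.
by split=> //; rewrite rmorphN mulNr.
Qed.

Lemma reducesB x y x' y' :
  reduces x x' -> reduces y y' -> reduces (x - y) (x' - y').
Proof. by move=> hx hy; apply/reducesD/reducesN. Qed.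

Lemma reducesX x x' n : reduces x x' -> reduces (x ^+ n) (x' ^+ n).
Proof.
move=> hx; elim: n => [|n IHn]; first exact: (reduces_nat 1%N).
by rewrite !exprS; apply: reducesM.
Qed.

Lemma reducesV x x' : reduces x x' -> x' != 0 -> reduces x^-1 x'^-1.
Proof.
move=> [a [b [b0 -> ->]]]; rewrite mulf_eq0 invr_eq0 (negPf b0) orbF => a0.
by exists b, a; rewrite a0 !invf_div.
Qed.

Lemma reduces_sum I (r : seq I) (P : pred I) f g :
  (forall i, P i -> reduces (f i) (g i)) ->
  reduces (\sum_(i <- r | P i) f i) (\sum_(i <- r | P i) g i).
Proof.
move=> h; elim/big_rec2: _ => [|i x y Pi hxy]; first exact: (reduces_nat 0%N).
by apply: reducesD => //; apply: h.
Qed.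

Lemma reduces_prod I (r : seq I) (P : pred I) f g :
  (forall i, P i -> reduces (f i) (g i)) ->
  reduces (\prod_(i <- r | P i) f i) (\prod_(i <- r | P i) g i).
Proof.
move=> h; elim/big_rec2: _ => [|i x y Pi hxy]; first exact: (reduces_nat 1%N).
by apply: reducesM => //; apply: h.
Qed.

Lemma reduces_inj x y y' : reduces x y -> reduces x y' -> y = y'.
Proof.
move=> [a [b [b0 -> ->]]] [c [d [d0 e ->]]].
move/eqP: e; rewrite eqr_div ?intr_rat_neq0 // -!intrM eqr_int => /eqP e.
by apply/eqP; rewrite eqr_div // -!intrM e.
Qed.

Lemma denq_dvd (a b : int) : b != 0 -> (denq (a%:~R / b%:~R) %| b)%Z.
Proof.
move=> b0; set x : rat := _ / _.
have e : numq x * b = a * denq x.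
  apply/eqP; rewrite -(eqr_int rat) !intrM -eqr_div ?divq_num_den //.
  - by rewrite intr_eq0 denq_eq0.
  - by rewrite intr_eq0.
rewrite -(@Gauss_dvdzr _ (numq x)).
  by rewrite e dvdz_mull.
rewrite coprimez_sym /coprimez; move: (coprime_num_den x).
by rewrite /coprime /gcdz => /eqP ->.
Qed.

(** The reduced denominator divides [b], so it too is nonzero in [F], and [ratr] computes the
    reduction. *)
Lemma reduces_ratr x y : reduces x y -> y = ratr x.
Proof.
move=> h; apply: (reduces_inj h); exists (numq x), (denq x).
rewrite divq_num_den; split=> //.
case: h => a [b [b0 -> _]]; apply: contraNneq b0 => e.
have [->//|/(denq_dvd a)/dvdzP[c ->]] := eqVneq b 0.
by rewrite intrM e mulr0.
Qed.

Lemma reducesP x (y : F) : reduces x y -> reduces x (ratr x : F).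
Proof. by move=> h; rewrite -(reduces_ratr h). Qed.

(* [pint x]: the denominator of x is invertible in F. *)
Local Notation pint x := (reduces x (ratr x : F)).

Lemma pint_int (n : int) : pint n%:~R. Proof. exact/reducesP/reduces_int. Qed.

Lemma pint_nat n : pint n%:R. Proof. exact/reducesP/reduces_nat. Qed.

Lemma pintB x y : pint x -> pint y -> pint (x - y).
Proof. by move=> hx hy; apply/reducesP/reducesB; eassumption. Qed.

Lemma pintD x y : pint x -> pint y -> pint (x + y).
Proof. by move=> hx hy; apply/reducesP/reducesD; eassumption. Qed.

Lemma pintM x y : pint x -> pint y -> pint (x * y).
Proof. by move=> hx hy; apply/reducesP/reducesM; eassumption. Qed.

Lemma pintX x n : pint x -> pint (x ^+ n).
Proof. by move=> hx; apply/reducesP/reducesX; eassumption. Qed.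

Lemma pintV_nat n : n%:R != 0 :> F -> pint n%:R^-1.
Proof. by move=> n0; apply/reducesP/(reducesV _ n0)/reduces_nat. Qed.

Lemma pint_sum I (r : seq I) (P : pred I) f :
  (forall i, P i -> pint (f i)) -> pint (\sum_(i <- r | P i) f i).
Proof. by move=> h; apply: (reducesP (reduces_sum _ h)). Qed.

End Reduction.

(** The difference is a fraction [a / b] reducing to 0, so [a = c p]; the reduced denominator of
    [c / b] divides [b], which is prime to [p]. *)
Lemma eqmod_rat_reduces (F : fieldType) p (x y : rat) (z : F) :
  p \in [pchar F] -> reduces x z -> reduces y z -> eqmod_rat p x y.
Proof.
move=> hp hx hy; have := reducesB hx hy; rewrite subrr => -[a [b [b0 e /eqP]]].
rewrite eq_sym mulf_eq0 invr_eq0 (negPf b0) orbF -(dvdz_pcharf hp).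
move=> /dvdzP[c ac].
exists (c%:~R / b%:~R); first by rewrite e ac intrM mulrAC mulrC.
rewrite -(dvdz_pcharf hp) in b0.
apply: contra (b0) => h; apply: (dvdz_trans h); apply: denq_dvd.
by apply: contraNneq b0 => ->; rewrite dvdz0.
Qed.

(** * Powers of the truncated logarithm *)

Section CoefLog.
Variables (F : fieldType) (p : nat) (hp : p \in [pchar F]).

Let p_pr : prime p := pcharf_prime hp.
Let p_gt0 : (0 < p)%N := prime_gt0 p_pr.

Lemma pchar_natf_neq0 i : (0 < i < p)%N -> i%:R != 0 :> F.
Proof.
by move=> /andP[i0 ip]; rewrite -(dvdn_pcharf hp); rewrite gtnNdvd.
Qed.

Lemma pchar_natrB i : (i <= p)%N -> (p - i)%:R = - i%:R :> F.
Proof. by move=> ip; rewrite natrB // (pcharf0 hp) sub0r. Qed.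

(* [- log (1 - z)] truncated below degree [p]; the term [k = 0] vanishes since
   [0^-1 = 0]. *)
Definition trunc_log1m : {poly F} := \poly_(k < p) k%:R^-1.

Lemma deriv_trunc_log1m :
  (1 - 'X) * trunc_log1m^`() = 1 - 'X^(p.-1).
Proof.
have -> : trunc_log1m^`() = \sum_(i < p.-1) 'X^i.
  apply/polyP => i; rewrite coef_deriv coef_poly.
  have -> : \sum_(i < p.-1) 'X^i = \poly_(i < p.-1) 1 :> {poly F}.
    by rewrite poly_def; apply: eq_bigr => j _; rewrite scale1r.
  rewrite coef_poly (_ : (i < p.-1)%N = (i.+1 < p)%N); last by lia.
  case: ifP => ip; last by rewrite mul0rn.
  by rewrite -[_ *+ _]mulr_natr mulVf // pchar_natf_neq0.
by rewrite -opprB mulNr -subrX1 opprB.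
Qed.

(** Coefficient of [z^m] in [(1 - z) (l^(k+1))' = (k+1) l^k (1 - z^(p-1))]. *)
Lemma coef_trunc_log1mX k m : (0 < k)%N -> (m < p)%N ->
  m.+1%:R * (trunc_log1m ^+ k.+1)`_m.+1 - m%:R * (trunc_log1m ^+ k.+1)`_m
  = k.+1%:R * (trunc_log1m ^+ k)`_m.
Proof.
move=> k0 mp.
have e : (1 - 'X) * (trunc_log1m ^+ k.+1)^`() =
         k.+1%:R *: (trunc_log1m ^+ k * (1 - 'X^(p.-1))).
  rewrite deriv_exp -deriv_trunc_log1m /= scaler_nat.
  by rewrite mulrnAr mulrA [in RHS]mulrC.
move/(congr1 (fun q : {poly F} => q`_m)): e.
rewrite mulrBl mul1r coefB coefXM coefZ mulrBr mulr1 coefB coefMXn !coef_deriv.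
(* The correction [z^(p-1) l^k] matters only at [m = p - 1], where it contributes the constant term
   of [l^k], zero for [k > 0]. *)
have -> : (if (m < p.-1)%N then 0 else (trunc_log1m ^+ k)`_(m - p.-1)) = 0.
  case: ltnP => // mp'; have -> : (m - p.-1 = 0)%N by lia.
  by rewrite -horner_coef0 horner_exp horner_coef0 coef_poly p_gt0 invr0 expr0n;
    case: k k0.
rewrite subr0 => <-; rewrite !mulr_natl; congr (_ - _).
by case: m mp => [|m] _ //=; rewrite coef_deriv.
Qed.

(** Up to the factor [- k!], the coefficient of [z^(p-i-1)] in [l^k]; indices start at 0. *)
Definition altsum k i : F :=
  \sum_(j < i.+1) (-1) ^+ j * 'C(i, j)%:R * (j.+1%:R^-1) ^+ k.

Lemma altsum0 k : altsum k 0 = 1.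
Proof. by rewrite /altsum big_ord1 bin0 invr1 expr1n !mulr1. Qed.

Lemma altsum_mul k i : (i.+1 < p)%N ->
  i.+1%:R * altsum k.+1 i =
  \sum_(j < i.+1) (-1) ^+ j * 'C(i.+1, j.+1)%:R * (j.+1%:R^-1) ^+ k.
Proof.
move=> ip; rewrite mulr_sumr; apply: eq_bigr => -[j /= ji] _.
have j0 : j.+1%:R != 0 :> F by apply: pchar_natf_neq0; lia.
have := mul_bin_diag i.+1 j => /(congr1 (fun x => x%:R : F)).
rewrite /= !natrM exprS => e.
transitivity ((-1) ^+ j * (i.+1%:R * 'C(i, j)%:R) *
    (j.+1%:R^-1 * j.+1%:R^-1 ^+ k) : F).
  ring.
by rewrite e (mulrC j.+1%:R) !mulrA mulfK.
Qed.

(** Pascal's rule, once the factor in front is absorbed into the binomial coefficients. *)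
Lemma altsumS k i : (i.+2 < p)%N ->
  i.+2%:R * altsum k.+1 i.+1 = i.+1%:R * altsum k.+1 i + altsum k i.+1.
Proof.
move=> ip; rewrite !altsum_mul ?(ltnW ip) //.
have -> : \sum_(j < i.+1) (-1) ^+ j * 'C(i.+1, j.+1)%:R * j.+1%:R^-1 ^+ k =
   \sum_(j < i.+2) (-1) ^+ j * 'C(i.+1, j.+1)%:R * j.+1%:R^-1 ^+ k :> F.
  by rewrite [RHS]big_ord_recr /= (bin_small (n := i.+1) (m := i.+2)) // mulr0
    mul0r addr0.
rewrite -big_split; apply: eq_bigr => j _ /=.
by rewrite binS natrD mulrDr mulrDl.
Qed.

(** Expansion of [(1 - 1)^(i+1) = 0] with the constant term moved to the other side. *)
Lemma altsum1 i : (i.+1 < p)%N -> altsum 1 i = i.+1%:R^-1.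
Proof.
move=> ip; have i0 : i.+1%:R != 0 :> F by apply: pchar_natf_neq0.
apply: (mulfI i0); rewrite altsum_mul // mulfV //.
have := exprBn_comm i.+1 (mulrC 1 1 : @GRing.comm F 1 1).
rewrite subrr expr0n big_ord_recl /= bin0 expr0 !expr1n !mulr1 mulr1n.
move/eqP; rewrite eq_sym addr_eq0 => /eqP e.
rewrite [RHS]e -sumrN; apply: eq_bigr => j _.
by rewrite expr0 mulr1 !expr1n !mulr1 /bump /= add1n exprS mulN1r mulNrn opprK
  mulr_natr.
Qed.

(** Since [p = 0] in [F], the coefficient recurrence read downwards from [z^p] is that of [altsumS].
    No starting value is required: at [j = 0] the coefficient of [z^p] is multiplied by 0. *)
Lemma coef_trunc_log1mX_altsum k i : (i < p.-1)%N ->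
  (trunc_log1m ^+ k.+1)`_(p - i.+1) = - (k.+1)`!%:R * altsum k.+1 i.
Proof.
elim: k i => [|k IHk] i ip.
  rewrite expr1 coef_poly altsum1; last by lia.
  rewrite ifT; last by lia.
  by rewrite pchar_natrB ?invrN ?mulN1r //; lia.
have step j : (j < p.-1)%N ->
    j.+1%:R * (trunc_log1m ^+ k.+2)`_(p - j.+1) =
    j%:R * (trunc_log1m ^+ k.+2)`_(p - j) - (k.+2)`!%:R * altsum k.+1 j.
  move=> jp; have := @coef_trunc_log1mX k.+1 (p - j.+1) isT.
  rewrite -subSn; last by lia.
  rewrite subSS IHk // !pchar_natrB; [|lia|lia].
  move=> h; rewrite factS natrM.
  have {}h := h ltac:(lia).
  rewrite -[_ * _ in LHS]opprK -mulNr
    -(addKr ((- j%:R) * (trunc_log1m ^+ k.+2)`_(p - j)) (- (_ * _))) h.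
  by ring.
elim: i ip => [|i IHi] ip.
  by have := step 0%N ip; rewrite mul0r sub0r mul1r !altsum0 mulNr.
have i0 : i.+2%:R != 0 :> F by apply: pchar_natf_neq0; lia.
apply: (mulfI i0); rewrite step // IHi ?(ltnW ip) // [RHS]mulrCA altsumS;
  last by lia.
by ring.
Qed.
End CoefLog.

(** * The duality *)

(* The trace of the [i]-th power of a primitive 6th root of unity. *)
Definition tr6 (i : nat) : int := [:: 2; 1; -1; -2; -1; 1]`_(i %% 6).

Lemma legendre3D (a b : int) : legendre3 (b * 3 + a) = legendre3 a.
Proof.
by rewrite /legendre3 !(sameP dvdz_mod0P eqP) modzMDl.
Qed.

Lemma tr6_legendre3 (i : nat) :
  tr6 i = (-1) ^+ i * (legendre3 (i%:Z + 1) - legendre3 (i%:Z - 1)).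
Proof.
rewrite /tr6 {2 3 4}(divn_eq i 6); set q := (i %/ 6)%N.
have -> : ((q * 6 + i %% 6)%N : int) + 1 = (q * 2)%N%:Z * 3
  + ((i %% 6)%N%:Z + 1) by lia.
have -> : ((q * 6 + i %% 6)%N : int) - 1 = (q * 2)%N%:Z * 3
  + ((i %% 6)%N%:Z - 1) by lia.
rewrite !legendre3D -signr_odd oddD oddM andbF signr_odd.
have := ltn_pmod i (isT : (0 < 6)%N).
by move: (i %% 6)%N => [|[|[|[|[|[|r]]]]]].
Qed.

Lemma tr6_mod i : tr6 (i %% 6) = tr6 i.
Proof. by rewrite /tr6 modn_mod. Qed.

Lemma eq_tr6 (i j : nat) : (i = j %[mod 6])%N -> tr6 i = tr6 j.
Proof. by rewrite /tr6 => ->. Qed.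

Lemma tr6_ind (P : nat -> Prop) :
  (forall i, (i < 6)%N -> P i) -> (forall i, P (i %% 6)%N -> P i) ->
    forall i, P i.
Proof. by move=> P6 h i; apply/h/P6/ltn_pmod. Qed.

(** A primitive 6th root of unity is a root of [x^2 - x + 1]. *)
Lemma tr6SS i : tr6 i.+2 = tr6 i.+1 - tr6 i.
Proof.
elim/tr6_ind: i => [|i].
  by case=> [|[|[|[|[|[|]]]]]].
rewrite -(addn2 (i %% 6)%N) -(addn1 (i %% 6)%N) tr6_mod.
by rewrite -tr6_mod modnDml tr6_mod -[tr6 (_ + 1)]tr6_mod modnDml tr6_mod addn2
  addn1.
Qed.

Lemma tr6_add3 i : tr6 i.+3 = - tr6 i.
Proof. rewrite !tr6SS; ring. Qed.

Lemma prime_mod6 p : prime p -> (3 < p)%N -> (p %% 6 = 1 \/ p %% 6 = 5)%N.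
Proof.
move=> hp p3.
have h2 : ~~ (2 %| p)%N by rewrite dvdn_prime2 //; lia.
have h3 : ~~ (3 %| p)%N by rewrite dvdn_prime2 //; lia.
lia.
Qed.

Section Tr6Prime.
Variables (p : nat) (hp : prime p) (p3 : (3 < p)%N).

Lemma tr6_prime : tr6 p = 1.
Proof. by rewrite /tr6; have [->|->] := prime_mod6 hp p3. Qed.

(** Let [w] be a primitive 6th root of unity and [p = e] mod 6 with [e = 1] or [e = -1]. As
    [1 - w^e = w^(-e)] and [(-1)^j = w^(3j)], the left side is the trace of [w^(-j-e)]. The proof
    checks all residues mod 6. *)
Lemma tr6_dual j :
  (-1) ^+ j * (tr6 j.*2 - tr6 (p + j.*2)) = tr6 (j + p).
Proof.
have hj : (-1) ^+ j = (-1) ^+ (j %% 6)%N :> int.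
  by rewrite {1}(divn_eq j 6) -signr_odd oddD oddM andbF signr_odd.
rewrite hj.
rewrite (@eq_tr6 j.*2 (j %% 6).*2); last by rewrite -!muln2 modnMml.
rewrite (@eq_tr6 (p + j.*2) (p %% 6 + (j %% 6).*2)); last first.
  by rewrite -!muln2 -modnDmr -modnMml modnDmr modnDml.
rewrite (@eq_tr6 (j + p) (j %% 6 + p %% 6)); last by rewrite modnDm.
have := ltn_pmod j (isT : (0 < 6)%N); move: (j %% 6)%N.
by have [->|->] := prime_mod6 hp p3; case=> [|[|[|[|[|[|]]]]]].
Qed.

Lemma tr6_shift i a : tr6 (i + a * p) = tr6 (i %% 6 + a * (p %% 6)).
Proof. by apply: eq_tr6; rewrite modnDml -[RHS]modnDmr modnMmr modnDmr. Qed.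

Lemma tr6_sum_shift i : \sum_(a < 6) tr6 (i + a * p) = 0.
Proof.
under eq_bigr => a _ do rewrite tr6_shift.
rewrite !big_ord_recl big_ord0 /=.
have := ltn_pmod i (isT : (0 < 6)%N); move: (i %% 6)%N.
by have [->|->] := prime_mod6 hp p3; case=> [|[|[|[|[|[|]]]]]].
Qed.

(** For the primitive 6th root [v = w^p], the sum of [a v^a] over [a < 6] is
    [6 / (v - 1) = - 6 v]. *)
Lemma tr6_wsum_shift i : \sum_(a < 6) a%:Z * tr6 (i + a * p) = - 6 * tr6
  (i + p).
Proof.
under eq_bigr => a _ do rewrite tr6_shift.
rewrite -{2}(mul1n p) tr6_shift !big_ord_recl big_ord0 /=.
have := ltn_pmod i (isT : (0 < 6)%N); move: (i %% 6)%N.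
by have [->|->] := prime_mod6 hp p3; case=> [|[|[|[|[|[|]]]]]].
Qed.
End Tr6Prime.

(** Moebius inversion over the divisors of 6: [tr6] is a Ramanujan sum. *)
Lemma tr6_dvd i : tr6 i = 6 * (6 %| i)%:R - 3 * (3 %| i)%:R - 2 * (2 %| i)%:R
  + 1.
Proof.
have e (d : nat) : (d %| 6)%N -> (d %| i)%N = (d %| i %% 6)%N.
  by move=> d6; rewrite {1}(divn_eq i 6) dvdn_addr // dvdn_mull.
rewrite !e // -tr6_mod.
have := ltn_pmod i (isT : (0 < 6)%N); move: (i %% 6)%N.
by case=> [|[|[|[|[|[|]]]]]].
Qed.

Lemma big_ord_pred (V : nmodType) n (f : nat -> V) : (0 < n)%N ->
  \sum_(i < n) f i = \sum_(i < n.-1) f i + f n.-1.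
Proof. by case: n => // n _; rewrite big_ord_recr. Qed.

Lemma sum_tail_mul (R : pzRingType) (f g : nat -> R) N :
  \sum_(i < N.+1) (\sum_(i <= k < N) f k) * g i =
  \sum_(k < N) f k * \sum_(j < k.+1) g j.
Proof.
elim: N => [|N IHN]; first by rewrite big_ord1 big_nil mul0r big_ord0.
rewrite big_ord_recr /= big_geq // mul0r addr0 [RHS]big_ord_recr /= -IHN
  mulr_sumr.
rewrite -big_split; apply: eq_bigr => i _ /=.
by rewrite big_nat_recr ?mulrDl // -ltnS.
Qed.

(** * Binomial transforms of the trace sequence *)

Section Dual.
Variables (F : fieldType) (p : nat) (hp : p \in [pchar F]) (p3 : (3 < p)%N).

Let p_pr : prime p := pcharf_prime hp.

Local Notation c i := ((tr6 i)%:~R : F).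

Definition bintr s j : F := \sum_(i < p) c (i.+1 + s)%N * 'C(i, j)%:R.

(** Telescopes, because [c_i = c_(i+1) - c_(i+2)]. *)
Lemma bintr0 s : bintr s 0 = c s.+2 - c (p + s).+2.
Proof.
rewrite /bintr; elim: p => [|m IHm]; first by rewrite big_ord0 add0n subrr.
rewrite big_ord_recr IHm /= bin0 mulr1 addSn.
by rewrite (tr6SS (m + s).+1) rmorphB /=; ring.
Qed.

(** Pascal's rule relates shifts [t] and [t+1]; the recurrence of [c] and its sign change under a
    shift by 3 eliminate the other terms of index [j+1]. *)
Lemma bintrS s j : (j.+1 < p)%N -> bintr s j.+1 = bintr s.+2 j.
Proof.
move=> jp.
have rec t : bintr t j.+1 = bintr t.+1 j.+1 + bintr t.+1 j.
  rewrite /bintr -big_split /=.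
  pose g i := c (i + t.+1)%N * 'C(i, j.+1)%:R.
  transitivity (\sum_(i < p) g i.+1).
    (* Peel one term off either end: [C(0, j+1) = 0], and [C(p, j+1) = 0] in [F]. *)
    have /eqP := erefl (\sum_(i < p.+1) g i).
    rewrite {1}big_ord_recr big_ord_recl /= {2 3}/g bin0n mulr0 add0r.
    rewrite (bin_lt_pcharf_0 hp) // mulr0 addr0 => /eqP <-.
    by apply: eq_bigr => i _; rewrite /g addSnnS.
  by apply: eq_bigr => i _; rewrite /g binS natrD mulrDr addrC.
have lin t : bintr t.+2 j.+1 = bintr t.+1 j.+1 - bintr t j.+1.
  rewrite /bintr -sumrB; apply: eq_bigr => i _.
  by rewrite !addnS tr6SS rmorphB /= mulrBl.
have e3 : bintr s.+3 j.+1 = - bintr s j.+1.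
  by rewrite /bintr -sumrN; apply: eq_bigr => i _;
    rewrite !addnS tr6_add3 rmorphN mulNr.
by have := lin s.+1; rewrite e3 (rec s.+1) opprD addrA subrr sub0r => /oppr_inj.
Qed.

Lemma bintrE j : (j < p)%N -> bintr 0 j = c j.+1.*2 - c (p + j.+1.*2)%N.
Proof.
have h s : (j < p)%N -> bintr s j = bintr (s + j.*2) 0.
  elim: j s => [|j IHj] s jp; first by rewrite addn0.
  by rewrite bintrS // IHj ?(ltnW jp) // doubleS !addnS !addSn.
by move=> jp; rewrite h // bintr0 add0n doubleS !addnS.
Qed.

Lemma bin_pred_pchar j : (j < p)%N -> 'C(p.-1, j)%:R = (-1) ^+ j :> F.
Proof.
have p0 := prime_gt0 p_pr.
elim: j => [|j IHj] jp; first by rewrite bin0.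
have := bin_lt_pcharf_0 hp (k := j.+1) jp.
rewrite -{1}(prednK p0) binS natrD IHj ?(ltnW jp) // => /eqP.
by rewrite addr_eq0 exprS mulN1r => /eqP.
Qed.

(** The last term has denominator [p] and vanishes, as [0^-1 = 0]. *)
Definition bintrV j : F := \sum_(i < p) c i.+1 / i.+1%:R * 'C(i, j)%:R.

Definition dualc i : F := c (i + p)%N + 1.

(** Adding adjacent transforms gives [C(i+1, j+1) / (i+1) = C(i, j) / (j+1)], hence [bintr 0 j]
    without its last term [c_p C(p-1, j) = (-1)^j]. That missing term is the source of the [+ 1] in
    [dualc]. *)
Lemma bintrV_rec j : (j.+1 < p)%N ->
  (-1) ^+ j * (bintrV j + bintrV j.+1) = - dualc j.+1 / j.+1%:R.
Proof.
move=> jp; have p0 := prime_gt0 p_pr.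
have j0 : j.+1%:R != 0 :> F by apply: (pchar_natf_neq0 hp).
have -> : bintrV j + bintrV j.+1 = (bintr 0 j - (-1) ^+ j) / j.+1%:R.
  rewrite /bintrV /bintr -big_split /=.
  have -> : \sum_(i < p)
    (c i.+1 / i.+1%:R * 'C(i, j)%:R + c i.+1 / i.+1%:R * 'C(i, j.+1)%:R)
    = \sum_(i < p) c i.+1 / i.+1%:R * 'C(i.+1, j.+1)%:R.
    by apply: eq_bigr => i _; rewrite binS natrD mulrDr addrC.
  rewrite -(prednK p0) !big_ord_recr /= prednK // (pcharf0 hp) invr0 mulr0 mul0r
    addr0.
  rewrite addn0 tr6_prime // mul1r bin_pred_pchar ?(ltnW jp) // addrK mulr_suml.
  apply: eq_bigr => -[i /= ip] _; rewrite addn0.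
  have i0 : i.+1%:R != 0 :> F by apply: (pchar_natf_neq0 hp); lia.
  have := mul_bin_diag i.+1 j => /(congr1 (fun x => x%:R : F)).
  rewrite /= !natrM => e.
  have -> : 'C(i.+1, j.+1)%:R = i.+1%:R * 'C(i, j)%:R / j.+1%:R :> F.
    by rewrite e mulrAC divff ?mul1r.
  by rewrite !mulrA mulfVK.
rewrite mulrA mulrBr -expr2 sqrr_sign bintrE ?(ltnW jp) //.
congr (_ / _); rewrite /dualc -(tr6_dual p_pr p3) intrM rmorphXn /= rmorphN1
  rmorphB exprS /=.
ring.
Qed.

Lemma bintrV_last : bintrV p.-1 = 0.
Proof.
have p0 := prime_gt0 p_pr.
rewrite /bintrV (big_ord_pred (fun i => c i.+1 / i.+1%:R * 'C(i, p.-1)%:R)) //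
  prednK // (pcharf0 hp) invr0 mulr0 mul0r addr0.
by apply: big1 => i _; rewrite bin_small ?mulr0.
Qed.

(** Downward induction from [j = p - 1], where the transform vanishes. *)
Lemma bintrVE j : (j < p)%N ->
  (-1) ^+ j * bintrV j = - \sum_(j <= i < p.-1) dualc i.+1 / i.+1%:R.
Proof.
have p0 := prime_gt0 p_pr.
move=> jp; rewrite -(subKn (m := j) (n := p.-1)); last by lia.
have : (p.-1 - j <= p.-1)%N by lia.
elim: (p.-1 - j)%N => [|k IHk] kp;
  first by rewrite subn0 big_geq // bintrV_last mulr0 oppr0.
rewrite big_ltn; last by lia.
have e : (p.-1 - k = (p.-1 - k.+1).+1)%N by lia.
have {}IHk := IHk (ltnW kp); rewrite e in IHk.
rewrite opprD -IHk -mulNr -bintrV_rec; last by lia.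
by rewrite exprS; ring.
Qed.

Lemma dual_sum k : (0 < k)%N ->
  \sum_(i < p.-1) c i.+1 / i.+1%:R * (trunc_log1m F p ^+ k)`_(p - i.+1) =
  k`!%:R *
  \sum_(i < p.-1) dualc i.+1 / i.+1%:R * \sum_(j < i.+1) j.+1%:R^-1 ^+ k.
Proof.
case: k => // k _; have p0 := prime_gt0 p_pr.
under eq_bigr => i _ do rewrite (coef_trunc_log1mX_altsum hp) // mulrCA.
rewrite -mulr_sumr mulNr -mulrN; congr (_ * _).
(* Both ranges grow to [p] so that the sums can be exchanged: the new [i] carries [1/p = 0], each
   new [j] has [C(i, j) = 0]. *)
have -> : \sum_(i < p.-1) c i.+1 / i.+1%:R * altsum F k.+1 i =
   \sum_(i < p) \sum_(j < p)
     (c i.+1 / i.+1%:R * 'C(i, j)%:R) * ((-1) ^+ j * j.+1%:R^-1 ^+ k.+1).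
  rewrite (big_ord_pred
    (fun i => \sum_(j < p)
    (c i.+1 / i.+1%:R * 'C(i, j)%:R) * ((-1) ^+ j * j.+1%:R^-1 ^+ k.+1))) //.
  rewrite prednK // (pcharf0 hp) invr0 mulr0.
  rewrite [X in _ = _ + X]big1 ?addr0 => [|j _]; last by rewrite !mul0r.
  apply: eq_bigr => i _; rewrite /altsum mulr_sumr.
  rewrite -(big_mkord xpredT
    (fun j => c i.+1 / i.+1%:R *
    ((-1) ^+ j * 'C(i, j)%:R * j.+1%:R^-1 ^+ k.+1))).
  rewrite -(big_mkord xpredT
    (fun j => c i.+1 / i.+1%:R * 'C(i, j)%:R *
    ((-1) ^+ j * j.+1%:R^-1 ^+ k.+1))).
  rewrite [RHS](big_cat_nat (n := i.+1)) //=; last by have := ltn_ord i; lia.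
  rewrite [X in _ = _ + X]big_nat_cond [X in _ = _ + X]big1 ?addr0.
    by apply: eq_bigr => j _; ring.
  by move=> j /andP[/andP[ij _] _]; rewrite bin_small // mulr0 mul0r.
rewrite exchange_big /=.
under eq_bigr => j _ do rewrite -mulr_suml -/(bintrV j) mulrA
  [bintrV j * _]mulrC bintrVE // mulNr.
rewrite sumrN opprK.
have := sum_tail_mul (fun i => dualc i.+1 / i.+1%:R)
  (fun j => j.+1%:R^-1 ^+ k.+1) p.-1.
by rewrite prednK.
Qed.
End Dual.

(** * Bernoulli numbers *)

Lemma big_ord_widen0 (V : nmodType) n N (f : nat -> V) : (n <= N)%N ->
  (forall i, (n <= i)%N -> f i = 0) -> \sum_(i < N) f i = \sum_(i < n) f i.
Proof.
move=> nN f0; rewrite -(big_mkord xpredT f)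
  (big_cat_nat (n := n)) //= big_mkord.
by rewrite [X in _ + X]big_nat_cond [X in _ + X]big1 ?addr0 // =>
  i /andP[/andP[/f0]].
Qed.

Lemma exprD1n_widen (R : comPzRingType) (x : R) n N : (n < N)%N ->
  (x + 1) ^+ n = \sum_(s < N) 'C(n, s)%:R * x ^+ s.
Proof.
move=> nN; rewrite (@big_ord_widen0 _ n.+1 _
  (fun s => 'C(n, s)%:R * x ^+ s)) //.
  rewrite addrC exprDn; apply: eq_bigr => i _.
  by rewrite expr1n mul1r mulr_natl.
by move=> i ni; rewrite bin_small ?mul0r.
Qed.

Lemma bernoulli_rec m : \sum_(i < m) 'C(m, i)%:R * bernoulli i = (m == 1%N)%:R.
Proof.
have := bernoulli_egf m; rewrite /fps_mul big_ord_recr /= subnn mulr0 addr0.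
move=> /(congr1 (fun x => (m`!)%:R * x)); rewrite mulr_sumr => e.
transitivity ((m`!)%:R * (m == 1%N)%:R : rat); last first.
  by case: eqP => [->|]; rewrite ?mulr0 ?mulr1.
rewrite -e; apply: eq_bigr => i _.
have -> : expm1 (m - i) = ((m - i)`!)%:R^-1.
  by rewrite /expm1; case: (m - i)%N (subn_gt0 i m) (ltn_ord i) => [<-|].
rewrite -(bin_fact (ltnW (ltn_ord i))) !natrM.
have h k : (k`!)%:R != 0 :> rat by rewrite pnatr_eq0 -lt0n fact_gt0.
by field; rewrite !h.
Qed.

Definition berpoly M (x : rat) : rat :=
  \sum_(r < M.+1) 'C(M, r)%:R * bernoulli r * x ^+ (M - r).

Lemma berpoly0 M : berpoly M 0 = bernoulli M.
Proof.
rewrite /berpoly big_ord_recr /= subnn binn mulr1 mul1r big1 ?add0r // => i _.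
by rewrite expr0n subn_eq0 leqNgt ltn_ord mulr0.
Qed.

(** Both sides are the trinomial coefficient [M! / (r! s! (M-r-s)!)], or 0 when [r + s > M]. *)
Lemma bin_mul_sym M r s : ('C(M, r) * 'C(M - r, s) = 'C(M, s) * 'C(M - s, r))%N.
Proof.
have [h|h] := leqP (r + s) M; last first.
  have [rM|rM] := leqP r M; have [sM|sM] := leqP s M;
    rewrite ?(bin_small rM) ?(bin_small sM) ?mul0n //.
  - by rewrite !(@bin_small (M - _)) ?muln0 //; lia.
  - by rewrite (@bin_small (M - r)) ?muln0 //; lia.
  - by rewrite (@bin_small (M - s)) ?muln0 //; lia.
have f0 k := fact_gt0 k.
have e1 := @bin_fact M r ltac:(lia); have e2 := @bin_fact (M - r) s ltac:(lia).
have e3 := @bin_fact M s ltac:(lia); have e4 := @bin_fact (M - s) r ltac:(lia).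
have e : (M - r - s = M - s - r)%N by lia.
rewrite e in e2.
apply/eqP; rewrite -(eqn_pmul2r (f0 r)) -(eqn_pmul2r (f0 s))
  -(eqn_pmul2r (f0 (M - s - r)%N)).
apply/eqP; move: e1 e2 e3 e4; nia.
Qed.

(** The coefficient of [x^s] on the left is [C(M, s)] times the sum of [C(M-s, r) B_r] over
    [r <= M-s], which the recurrence evaluates. *)
Lemma berpolyD1 M x : berpoly M (x + 1) = berpoly M x + M%:R * x ^+ M.-1.
Proof.
transitivity (\sum_(s < M.+1) 'C(M, s)%:R * x ^+ s *
                (bernoulli (M - s) + ((M - s)%N == 1%N)%:R)).
  transitivity (\sum_(r < M.+1) \sum_(s < M.+1)
    ('C(M, s) * 'C(M - s, r))%:R * x ^+ s * bernoulli r).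
    apply: eq_bigr => r _;
      rewrite (@exprD1n_widen _ x _ M.+1) ?ltnS ?leq_subr // mulr_sumr.
    by apply: eq_bigr => s _; rewrite -bin_mul_sym natrM; ring.
  rewrite exchange_big; apply: eq_bigr => s _ /=.
  have -> : bernoulli (M - s) + ((M - s)%N == 1%N)%:R =
            \sum_(i < (M - s).+1) 'C(M - s, i)%:R * bernoulli i.
    by rewrite big_ord_recr /= bernoulli_rec binn mul1r addrC.
  rewrite -(@big_ord_widen0 _ _ M.+1 (fun i => 'C(M - s, i)%:R * bernoulli i))
    ?ltnS ?leq_subr //.
    by rewrite mulr_sumr; apply: eq_bigr => i _; rewrite natrM; ring.
  by move=> i hi; rewrite bin_small ?mul0r.
rewrite (reindex_inj rev_ord_inj) /= /berpoly.
transitivity (\sum_(r < M.+1) ('C(M, r)%:R * bernoulli r * x ^+ (M - r) +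
    'C(M, r)%:R * (r == 1%N :> nat)%:R * x ^+ (M - r))).
  apply: eq_bigr => -[r /= rM] _; rewrite subSS bin_sub; last by lia.
  by rewrite subKn; [ring|lia].
rewrite big_split /=; congr (_ + _).
case: M => [|M]; first by rewrite big_ord1 mulr0 !mul0r.
rewrite 2!big_ord_recl /= big1 => [|i _]; last by rewrite mulr0 mul0r.
by rewrite mulr0 mul0r add0r addr0 mulr1 bin1 subSS subn0.
Qed.

Lemma faulhaber_berpoly m n :
  m.+1%:R * \sum_(k < n) k%:R ^+ m = berpoly m.+1 n%:R - bernoulli m.+1.
Proof.
elim: n => [|n IHn]; first by rewrite big_ord0 mulr0 berpoly0 subrr.
by rewrite big_ord_recr /= mulrDr IHn -[n.+1%:R]natr1 berpolyD1 addrAC.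
Qed.

Lemma faulhaber m n :
  m.+1%:R * \sum_(k < n) k%:R ^+ m =
  \sum_(r < m.+1) 'C(m.+1, r)%:R * bernoulli r * n%:R ^+ (m.+1 - r).
Proof.
rewrite faulhaber_berpoly /berpoly big_ord_recr /= subnn binn mulr1 mul1r.
by rewrite addrK.
Qed.

(** By the difference equation at [x = -1], both sides satisfy the same triangular recurrence, with
    right-hand side [M]. *)
Lemma bernoulli_reflect m :
  (-1) ^+ m * bernoulli m = bernoulli m + (m == 1%N)%:R.
Proof.
have sumE M : (0 < M)%N ->
    \sum_(r < M) 'C(M, r)%:R * ((-1) ^+ r * bernoulli r) =
    \sum_(r < M) 'C(M, r)%:R * (bernoulli r + (r == 1%N :> nat)%:R).
  move=> M0.
  have := berpolyD1 M (-1);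
    rewrite addNr berpoly0 /berpoly big_ord_recr /= subnn binn mulr1 mul1r.
  move=> /(congr1 (fun x => (-1) ^+ M * (x - bernoulli M))).
  rewrite subrr mulr0 addrAC addrK mulrDr mulr_sumr.
  move=> /esym/eqP; rewrite addr_eq0 => /eqP e.
  transitivity (M%:R : rat).
    transitivity (\sum_(i < M)
      (-1) ^+ M * ('C(M, i)%:R * bernoulli i * (-1) ^+ (M - i)) : rat).
      apply: eq_bigr => -[i /= iM] _.
      rewrite [_ * (-1) ^+ (M - i)]mulrC [RHS]mulrA -exprD
        (_ : M + (M - i) = i + (M - i).*2)%N; last by lia.
      by rewrite exprD -muln2 exprM sqrr_sign mulr1; ring.
    rewrite e mulrCA -exprD -mulrN -[X in _ * - X]signr_odd (_ : odd _ = true)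
      ?expr1 ?opprK ?mulr1 //.
    by case: M M0 {e} => // M _; rewrite /= addnn odd_double.
  under [RHS]eq_bigr => i _ do rewrite mulrDr.
  rewrite big_split /= bernoulli_rec.
  case: M M0 {e} => [|[|M]] // _; first by rewrite big_ord1 /= mulr0 addr0.
  rewrite 2!big_ord_recl /= big1 => [|i _]; last by rewrite mulr0.
  by rewrite mulr0 !add0r addr0 mulr1 bin1.
elim/ltn_ind: m => m IHm; have := sumE m.+1 isT.
rewrite !big_ord_recr /=
  (eq_bigr (fun r : 'I_m =>
  'C(m.+1, r)%:R * (bernoulli r + (r == 1%N :> nat)%:R))).
  move=> /addrI; apply: mulfI.
  by rewrite binSn pnatr_eq0.
by move=> i _; rewrite IHm.
Qed.

Lemma bernoulli_odd m : odd m -> (1 < m)%N -> bernoulli m = 0.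
Proof.
move=> mo m1; have := bernoulli_reflect m.
rewrite -signr_odd mo expr1 mulN1r (gtn_eqF m1) addr0 => /eqP.
by rewrite eq_sym -addr_eq0 -mulr2n mulrn_eq0 => /eqP.
Qed.

Lemma bernoulli_0 : bernoulli 0 = 1.
Proof. by have := bernoulli_rec 1; rewrite big_ord1 mul1r. Qed.

Lemma bernoulli_1 : bernoulli 1 = - 2%:R^-1.
Proof.
have := bernoulli_rec 2; rewrite !big_ord_recr big_ord0 /= bernoulli_0.
rewrite bin0 bin1 add0r mul1r => e.
apply: (mulfI (_ : 2%:R != 0)) => //; rewrite mulrN divff //.
by apply/eqP; rewrite -addr_eq0 addrC e.
Qed.

Lemma big_ord_mul (V : nmodType) M d (f : nat -> V) :
  \sum_(i < M * d) f i = \sum_(a < M) \sum_(i < d) f (i + a * d)%N.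
Proof.
elim: M => [|M IHM]; first by rewrite !big_ord0.
rewrite big_ord_recr /= -IHM mulSn addnC big_split_ord /=; congr (_ + _).
by apply: eq_bigr => i _; rewrite addnC.
Qed.

Lemma sum_dvdn_ord M d (f : nat -> rat) : (0 < d)%N ->
  \sum_(i < M * d) (d %| i)%:R * f i = \sum_(a < M) f (a * d)%N.
Proof.
case: d => // d _.
rewrite (@big_ord_mul _ M d.+1 (fun i => (d.+1 %| i)%:R * f i)).
apply: eq_bigr => a _; rewrite big_ord_recl add0n dvdn_mull // mul1r.
rewrite big1 ?addr0 // => i _; rewrite dvdn_addl ?dvdn_mull //.
by rewrite gtnNdvd ?mul0r // ltnS /bump add1n.
Qed.

Lemma expnD_mod2 i y m : exists t : nat,
  ((i + y) ^ m = i ^ m + m * y * i ^ m.-1 + y ^ 2 * t)%N.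
Proof.
elim: m => [|m [t IHm]]; first by exists 0%N; rewrite !expn0 !mul0n muln0.
(* Collects the multiples of [y^2] in [(i + y) (i^m + m y i^(m-1) + y^2 t)]. *)
exists (m * i ^ m.-1 + (i + y) * t)%N; rewrite expnS IHm.
have e : (m * (i * i ^ m.-1) = m * i ^ m)%N by case: m {IHm} => // m;
  rewrite -expnS.
move: (congr1 (muln y) e); rewrite /= expnS ?expnS ?expn0 ?muln1.
by move: (i ^ m)%N (i ^ m.-1)%N => u v; lia.
Qed.

(** * Integrality at [p] and power sums modulo [p^2] *)

Section BernoulliMod.
Variables (F : fieldType) (p : nat) (hp : p \in [pchar F]) (p3 : (3 < p)%N).

Let p_pr : prime p := pcharf_prime hp.
Local Notation c i := ((tr6 i)%:~R).

Local Notation pint x := (reduces x (ratr x : F)).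

(** The recurrence involves only [B_i] with [i + 1 < p]. The factor [r + 1] allows [r = p - 1]. *)
Lemma pint_bernoulli_mul r : (r < p)%N -> pint (r.+1%:R * bernoulli r).
Proof.
elim/ltn_ind: r => r IHr rp.
have := bernoulli_rec r.+1; rewrite big_ord_recr /= binSn.
move=> /(canRL (addKr _)) ->; rewrite addrC; apply: pintB;
  first exact: pint_nat.
apply: pint_sum => -[i /= ir] _; apply: pintM; first exact: pint_nat.
rewrite -[bernoulli i](mulKf (_ : i.+1%:R != 0)) ?pnatr_eq0 //.
apply: pintM; last by apply: IHr => //; lia.
by apply/pintV_nat/(pchar_natf_neq0 hp); lia.
Qed.

Lemma pint_bernoulli r : (r.+1 < p)%N -> pint (bernoulli r).
Proof.
move=> rp; rewrite -[bernoulli r](mulKf (_ : r.+1%:R != 0)) ?pnatr_eq0 //.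
apply: pintM; last by apply: pint_bernoulli_mul; lia.
by apply/pintV_nat/(pchar_natf_neq0 hp).
Qed.

(** Faulhaber's formula over [m + 1]: the term [r = m] is [M p B_m], the others contain
    [(M p)^(m+1-r) / (m+1-r)] with exponent at least 2. *)
Lemma power_sum_mod2 m M : (0 < m < p)%N ->
  exists z : rat, reduces z (ratr z : F) /\
    \sum_(k < M * p) k%:R ^+ m = (M * p)%:R * bernoulli m + p%:R ^+ 2 * z.
Proof.
move=> /andP[m0 mp]; pose e r := (m.+1 - r)%N.
exists (\sum_(r < m) 'C(m, r)%:R * bernoulli r * M%:R ^+ e r *
  (p%:R ^+ (e r - 2) / (e r)%:R)).
split.
  apply: pint_sum => -[r /= rm] _; apply: pintM; first apply: pintM;
    first apply: pintM.
  - exact: pint_nat.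
  - by apply: pint_bernoulli; lia.
  - exact/pintX/pint_nat.
  (* Exponent [p] occurs only for [m = p - 1], [r = 0]; then [p^(p-2)] absorbs the denominator
     [p]. *)
  have [->|ep] := eqVneq (e r) p.
    rewrite (_ : _ / _ = (p ^ (p - 3))%:R); first exact: pint_nat.
    rewrite natrX (_ : (p - 2 = (p - 3).+1)%N); last by lia.
    by rewrite exprSr mulfK // pnatr_eq0; lia.
  apply: pintM; first exact/pintX/pint_nat.
  by apply/pintV_nat/(pchar_natf_neq0 hp); rewrite /e in ep *; lia.
have m1 : m.+1%:R != 0 :> rat by rewrite pnatr_eq0.
apply: (mulfI m1); rewrite faulhaber big_ord_recr /= binSn subSnn expr1.
rewrite mulrDr addrC; congr (_ + _); first by ring.
rewrite mulrCA !mulr_sumr; apply: eq_bigr => -[r /= rm] _.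
have er : (e r)%:R != 0 :> rat by rewrite pnatr_eq0 /e; lia.
have -> : 'C(m.+1, r)%:R = m.+1%:R * 'C(m, r)%:R / (e r)%:R :> rat.
  by rewrite -natrM (mul_bin_down m.+1 r) natrM mulrAC divff ?mul1r.
rewrite -/(e r) natrM exprMn.
have -> : p%:R ^+ e r = p%:R ^+ 2 * p%:R ^+ (e r - 2) :> rat.
  by rewrite -exprD subnKC // /e; lia.
by ring.
Qed.

(** By [tr6_dvd], four power sums over multiples of 6, 3, 2, 1 combine through [6^m - 3^m - 2^m + 1
    = (2^m - 1) (3^m - 1)]. *)
Lemma sum_tr6_pow_mod2 m : (0 < m < p)%N ->
  exists z : rat, reduces z (ratr z : F) /\
    \sum_(k < 6 * p) c k * k%:R ^+ m =
    6%:R * p%:R * ((2%:R ^+ m - 1) * (3%:R ^+ m - 1) * bernoulli m)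
      + p%:R ^+ 2 * z.
Proof.
move=> hm.
have [z1 [rz1 e1]] := power_sum_mod2 1 hm.
have [z2 [rz2 e2]] := power_sum_mod2 2 hm.
have [z3 [rz3 e3]] := power_sum_mod2 3 hm.
have [z6 [rz6 e6]] := power_sum_mod2 6 hm.
exists (6%:R * (6%:R ^+ m * z1) - 3%:R * (3%:R ^+ m * z2)
  - 2%:R * (2%:R ^+ m * z3) + z6).
split.
  have rn := pint_nat.
  by apply: pintD rz6; apply: pintB; first apply: pintB;
    apply: pintM => //; apply: pintM => //; apply: pintX.
transitivity (6%:R * (\sum_(k < 6 * p) (6 %| k)%:R * k%:R ^+ m) -
    3%:R * (\sum_(k < 6 * p) (3 %| k)%:R * k%:R ^+ m) -
    2%:R * (\sum_(k < 6 * p) (2 %| k)%:R * k%:R ^+ m) +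
    \sum_(k < 6 * p) k%:R ^+ m : rat).
  rewrite !mulr_sumr -!sumrB -big_split; apply: eq_bigr => k _ /=.
  by rewrite tr6_dvd rmorphD !rmorphB !rmorphM /= -!pmulrn; ring.
have sd d M : (0 < d)%N -> (6 * p = M * d)%N ->
    \sum_(k < 6 * p) (d %| k)%:R * k%:R ^+ m =
    d%:R ^+ m * \sum_(k < M) k%:R ^+ m :> rat.
  move=> d0 ->; rewrite (sum_dvdn_ord M (fun k => k%:R ^+ m)) // mulr_sumr.
  by apply: eq_bigr => k _; rewrite natrM exprMn mulrC.
rewrite (sd 6%N (1 * p)%N) // ?(sd 3%N (2 * p)%N) ?(sd 2%N (3 * p)%N) //;
  try lia.
rewrite e1 e2 e3 e6 !(natrM _ _ p).
have -> : 6%:R ^+ m = 2%:R ^+ m * 3%:R ^+ m :> rat by rewrite -exprMn -natrM.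
ring.
Qed.

(** Put [k = i + a p] and expand [k^m] modulo [p^2]: summed over [a], the constant term cancels and
    the linear one gives [- 6 p m c_(i+p) i^(m-1)]. The product is reduced as a whole, since
    [m = p - 1] is allowed. *)
Lemma bernoulli_tr6_reduces m : (0 < m < p)%N ->
  reduces ((2%:R ^+ m - 1) * (3%:R ^+ m - 1) * bernoulli m)
    (- m%:R * \sum_(i < p) c (i + p)%N * i%:R ^+ m.-1 : F).
Proof.
move=> hm; have [z [rz e]] := sum_tr6_pow_mod2 hm.
have p0 : p%:R != 0 :> rat by rewrite pnatr_eq0; lia.
pose w (i a : nat) : rat :=
  ((i + a * p)%:R ^+ m - i%:R ^+ m - m%:R * (a * p)%:R * i%:R ^+ m.-1) /
  p%:R ^+ 2.
have rw i a : reduces (w i a) (ratr (w i a) : F).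
  have [t et] := expnD_mod2 i (a * p) m.
  have -> : w i a = (a ^ 2 * t)%:R.
    rewrite /w -!natrX et !natrD !natrM !natrX; field; exact: p0.
  exact: pint_nat.
pose S : rat := \sum_(i < p) c (i + p)%N * i%:R ^+ m.-1.
pose z' : rat := \sum_(i < p) \sum_(a < 6) c (i + a * p)%N * w i a.
have e' : \sum_(k < 6 * p) c k * k%:R ^+ m =
    - 6%:R * p%:R * (m%:R * S) + p%:R ^+ 2 * z'.
  rewrite (big_ord_mul 6 p (fun k => c k * k%:R ^+ m)) exchange_big /=.
  rewrite /S /z' !mulr_sumr -big_split; apply: eq_bigr => i _ /=.
  transitivity (\sum_(a < 6) (c (i + a * p)%N * i%:R ^+ m +
     m%:R * p%:R * i%:R ^+ m.-1 * (a%:R * c (i + a * p)%N) +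
      p%:R ^+ 2 * (c (i + a * p)%N * w i a)) : rat).
    apply: eq_bigr => a _; rewrite /w natrM; field; exact: p0.
  rewrite !big_split /= -mulr_suml -!mulr_sumr; congr (_ + _).
  have -> : \sum_(a < 6) c (i + a * p)%N = 0 :> rat.
    by rewrite -(rmorph_sum (intmul 1)) tr6_sum_shift.
  have -> : \sum_(a < 6) a%:R * c (i + a * p)%N = - 6%:R * c (i + p)%N :> rat.
    have := tr6_wsum_shift p_pr p3 i => /(congr1 (fun x : int => x%:~R : rat)).
    rewrite rmorph_sum /= rmorphM /= rmorphN /= => <-.
    by apply: eq_bigr => a _; rewrite rmorphM.
  by ring.
(* Equating the two evaluations and dividing by [6 p] leaves an error that is still a multiple of
   [p]. *)
have -> : (2%:R ^+ m - 1) * (3%:R ^+ m - 1) * bernoulli m =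
    - m%:R * S + p%:R * ((z' - z) / 6%:R).
  have h6 : 6%:R * p%:R != 0 :> rat by rewrite mulf_neq0.
  apply: (mulfI h6); apply: (addIr (p%:R ^+ 2 * z)); rewrite -e e'.
  by field.
have n6 : 6%:R != 0 :> F.
  by rewrite (natrM _ 2 3) mulf_neq0 //; apply: (pchar_natf_neq0 hp); lia.
have rz' : pint z'.
  apply: pint_sum => i _; apply: pint_sum => a _; apply: pintM; last exact: rw.
  exact: pint_int.
rewrite -[X in reduces _ X]addr0.
have p0F : p%:R * ratr ((z' - z) / 6%:R) = 0 :> F by rewrite (pcharf0 hp) mul0r.
rewrite -[X in reduces _ (_ + X)]p0F; apply: reducesD; last first.
  apply: reducesM; first exact: reduces_nat.
  by apply: pintM; [apply: pintB|apply: pintV_nat].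
apply: reducesM; first by apply/reducesN/reduces_nat.
apply: reduces_sum => i _; apply: reducesM; first exact: reduces_int.
exact/reducesX/reduces_nat.
Qed.

Lemma power_sum_pchar m : (m.+1 < p)%N -> \sum_(i < p) i%:R ^+ m = 0 :> F.
Proof.
case: m => [|m] mp.
  by rewrite sumr_const card_ord (pcharf0 hp).
have [z [rz e]] := @power_sum_mod2 m.+1 1 ltac:(lia).
have r0 : reduces (\sum_(k < p) k%:R ^+ m.+1)
  (p%:R * ratr (bernoulli m.+1) + p%:R ^+ 2 * ratr z : F).
  rewrite mul1n in e; rewrite e; apply: reducesD; apply: reducesM => //.
  - exact: reduces_nat.
  - exact: pint_bernoulli.
  - exact/reducesX/reduces_nat.
rewrite (pcharf0 hp) expr0n !mul0r addr0 in r0.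
apply: reduces_inj r0; apply: reduces_sum => i _.
exact/reducesX/reduces_nat.
Qed.

End BernoulliMod.

(** * The composition sum *)

Lemma sum_tuple_ffun (V : nmodType) (T : finType) n (P : pred (n.-tuple T))
  (f : n.-tuple T -> V) :
  \sum_(k : n.-tuple T | P k) f k =
  \sum_(g : {ffun 'I_n -> T} | P [tuple g i | i < n]) f [tuple g i | i < n].
Proof.
apply: reindex; exists (fun k : n.-tuple T => [ffun i => tnth k i]) => [g|k] _.
  by apply/ffunP => i; rewrite ffunE tnth_mktuple.
by apply: eq_from_tnth => i; rewrite tnth_mktuple ffunE.
Qed.

Lemma coef_prod_sumX (R : comNzRingType) n d (a : 'I_n -> nat -> R) m :
  (\prod_(i < n) \poly_(j < d) a i j)`_m =
  \sum_(g : {ffun 'I_n -> 'I_d} | (\sum_(i < n) g i == m)%N)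
    \prod_(i < n) a i (g i).
Proof.
under eq_bigr => i _ do rewrite poly_def.
rewrite bigA_distr_bigA /= coef_sum [RHS]big_mkcond; apply: eq_bigr => g _.
rewrite scaler_prod coefZ prodrXr coefXn eq_sym.
by case: eqP; rewrite ?mulr1 ?mulr0.
Qed.

Lemma big_ord_predl (V : nmodType) n (f : nat -> V) : (0 < n)%N ->
  \sum_(i < n) f i = f 0%N + \sum_(i < n.-1) f i.+1.
Proof. by case: n => // n _; rewrite big_ord_recl. Qed.

(** * From the composition sum to weighted power sums *)

Section Assembly.
Variables (F : fieldType) (p : nat) (hp : p \in [pchar F]) (p3 : (3 < p)%N).

Let p_pr : prime p := pcharf_prime hp.
Local Notation c i := ((tr6 i)%:~R).
Local Notation pint x := (reduces x (ratr x : F)).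

Lemma composition_sum_reduces n : (0 < n)%N ->
  reduces (composition_sum n.+1 p)
    (\sum_(i < p.-1) c i.+1 / i.+1%:R * (trunc_log1m F p ^+ n)`_(p - i.+1)).
Proof.
move=> n0.
pose a (i : 'I_n.+1) (j : nat) : F := (if i == ord0 then c j else 1) / j%:R.
have -> :
    \sum_(i < p.-1) c i.+1 / i.+1%:R * (trunc_log1m F p ^+ n)`_(p - i.+1) =
    (\prod_(i < n.+1) \poly_(j < p.+1) a i j)`_p.
  rewrite big_ord_recl /= (eq_bigr (fun=> trunc_log1m F p)) => [|i _];
    last first.
    apply/polyP => j; rewrite !coef_poly /a /= mul1r ltnS leq_eqVlt.
    by case: eqP => [->|] //=; rewrite (pcharf0 hp) invr0 ltnn.
  rewrite prodr_const card_ord coefM big_ord_recl /= coef_poly /a /= invr0 mulr0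
    mul0r add0r.
  rewrite (big_ord_pred
    (fun i => (\poly_(j < p.+1) (c j / j%:R))`_(bump 0 i) *
    (trunc_log1m F p ^+ n)`_(p - bump 0 i))); last by lia.
  rewrite coef_poly /bump /= add1n prednK ?ltnS ?leqnn; last by lia.
  rewrite (pcharf0 hp) invr0 mulr0 mul0r addr0; apply: eq_bigr => i _.
  by rewrite coef_poly add1n ifT //; have := ltn_ord i; lia.
have -> : (\prod_(i < n.+1) \poly_(j < p.+1) a i j)`_p =
    \sum_(k : n.+1.-tuple 'I_p.+1 | (\sum_(i < n.+1) tnth k i == p)%N)
       \prod_(i < n.+1) a i (tnth k i).
  rewrite coef_prod_sumX sum_tuple_ffun; apply: eq_big => g.
    by under [in RHS]eq_bigr => i _ do rewrite tnth_mktuple.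
  by move=> _; apply: eq_bigr => i _; rewrite tnth_mktuple.
(* Tuples with a zero entry contribute nothing, as [0^-1 = 0]. *)
rewrite (bigID (fun k : n.+1.-tuple 'I_p.+1 => [forall i, 0 < tnth k i]%N)) /=
  [X in _ + X]big1 ?addr0 => [|k]; last first.
  move=> /andP[_]; rewrite negb_forall => /existsP[i];
    rewrite -leqNgt leqn0 => /eqP ki.
  by rewrite (bigD1 i) //= ki /a invr0 mulr0 mul0r.
apply: reduces_sum => k /andP[/eqP ksum /forallP kpos].
(* There are at least two positive parts, so each is below [p] and invertible in [F]. *)
have kp i : (tnth k i < p)%N.
  have [j ji] : exists j : 'I_n.+1, j != i.
    have [->|i0] := eqVneq i ord0; last by exists ord0; rewrite eq_sym.
    by exists ord_max; rewrite -val_eqE /= -lt0n.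
  move: (kpos j) ksum; rewrite (bigD1 i) //= (bigD1 j) //=.
  by move: (\sum_(_ < _ | _) _)%N; lia.
have -> : head ord0 k = tnth k ord0 by rewrite (tnth_nth ord0) nth0.
have -> : \prod_(i < n.+1) a i (tnth k i) =
    (tr6 (tnth k ord0))%:~R / \prod_(i < n.+1) (tnth k i : nat)%:R.
  rewrite /a big_split /= prodfV; congr (_ * _).
  by rewrite (bigD1 ord0) //= big1 ?mulr1 // => i /negPf ->.
rewrite (_ : _ * _%:~R = (tr6 (tnth k ord0))%:~R); last first.
  by rewrite tr6_legendre3 rmorphM rmorphXn /= rmorphN1.
apply: reducesM; first exact: reduces_int.
apply: reducesV; first by apply: reduces_prod => i _; apply: reduces_nat.
apply/prodf_neq0 => i _; apply: (pchar_natf_neq0 hp).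
by rewrite kpos kp.
Qed.

Lemma natr_expp j : j%:R ^+ p = j%:R :> F.
Proof. by rewrite -(pFrobenius_autE hp) pFrobenius_aut_nat. Qed.

Lemma natr_exp_pred j : j%:R != 0 :> F -> j%:R ^+ p.-1 = 1 :> F.
Proof.
move=> j0; apply: (mulfI j0); rewrite -exprS prednK ?mulr1 ?natr_expp //; lia.
Qed.

Lemma natr_invX j k : (0 < k < p.-1)%N ->
  j%:R^-1 ^+ k = j%:R ^+ (p.-1 - k) :> F.
Proof.
move=> /andP[k0 kp]; have [->|j0] := eqVneq (j%:R : F) 0.
  by rewrite invr0 !expr0n subn_eq0 leqNgt kp eqn0Ngt k0.
apply: (mulIf (expf_neq0 k j0));
  rewrite -exprD subnK ?(ltnW kp) // natr_exp_pred //.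
by rewrite -exprMn mulVf // expr1n.
Qed.

Definition wsum e : F := \sum_(i < p.-1) dualc F p i.+1 * i.+1%:R ^+ e.

(* For indices below [p - 1] the Bernoulli numbers are [p]-integral, and [ratr]
   sends a [p]-integral rational to its reduction. *)
Lemma faulhaber_pchar q x : (0 < q < p)%N ->
  \sum_(k < x) k%:R ^+ q.-1 =
  q%:R^-1 *
  \sum_(r < q) 'C(q, r)%:R * ratr (bernoulli r) * x%:R ^+ (q - r) :> F.
Proof.
move=> /andP[q0 qp]; have qF : q%:R != 0 :> F by apply: (pchar_natf_neq0 hp);
  rewrite q0.
apply: (mulfI qF); rewrite mulVKf //.
have := faulhaber q.-1 x; rewrite prednK // => e.
apply: (@reduces_inj _ (q%:R * \sum_(k < x) k%:R ^+ q.-1)).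
  apply: reducesM; first exact: reduces_nat.
  by apply: reduces_sum => k _; apply/reducesX/reduces_nat.
rewrite e; apply: reduces_sum => -[r /= rq] _.
apply: reducesM; last exact/reducesX/reduces_nat.
apply: reducesM; first exact: reduces_nat.
by apply: (pint_bernoulli hp); lia.
Qed.

(** Fermat turns [j^-(n-1)] into [j^(q-1)]. Faulhaber covers [j < i], the term [j = i] yields
    [wsum q.-2], and the factor [1/i] lowers every exponent by one. *)
Lemma composition_sum_wsum n : (1 < n < p.-1)%N ->
  let q := (p - n.-1)%N in
  reduces (composition_sum n p)
    ((n.-1)`!%:R *
     (q%:R^-1 * \sum_(r < q) 'C(q, r)%:R * ratr (bernoulli r) * wsum (q - r).-1
      + wsum q.-2)).
Proof.
case: n => [|n] // /andP[n0 np] q; rewrite /= in q *.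
have := composition_sum_reduces n0; rewrite (dual_sum hp p3) //.
set S := \sum_(i < _) _; set T := (X in _ -> reduces _ (_ * X)).
suff -> : S = T by [].
have qF : (0 < q < p)%N by rewrite /q; lia.
have step i : (i < p.-1)%N -> \sum_(j < i.+1) j.+1%:R^-1 ^+ n =
    q%:R^-1 *
    (\sum_(r < q) 'C(q, r)%:R * ratr (bernoulli r) * i.+1%:R ^+ (q - r))
    + i.+1%:R ^+ q.-1 :> F.
  move=> ip; rewrite -faulhaber_pchar //
    (_ : _ + _ = \sum_(k < i.+2) k%:R ^+ q.-1); last first.
    by rewrite [RHS]big_ord_recr.
  rewrite [RHS]big_ord_recl /= expr0n (_ : (q.-1 == 0)%N = false) ?add0r;
    last by rewrite /q; lia.
  apply: eq_bigr => j _; rewrite natr_invX ?n0 //; last by lia.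
  by congr (_ ^+ _); rewrite /q; lia.
rewrite /S (eq_bigr (fun i : 'I_p.-1 =>
  q%:R^-1 * (\sum_(r < q) 'C(q, r)%:R * ratr (bernoulli r) *
    (dualc F p i.+1 * i.+1%:R ^+ (q - r).-1)) +
  dualc F p i.+1 * i.+1%:R ^+ q.-2)).
  rewrite big_split /= /T -mulr_sumr exchange_big /=; congr (_ * _ + _).
  by apply: eq_bigr => r _; rewrite -mulr_sumr.
move=> [i /= ip] _; rewrite step // mulrDr mulrCA mulr_sumr.
have i0 : i.+1%:R != 0 :> F by apply: (pchar_natf_neq0 hp); lia.
congr (_ * _ + _).
  apply: eq_bigr => -[r /= rq] _;
    rewrite -[in LHS](prednK (_ : 0 < q - r)%N) ?subn_gt0 // exprS.
  by move: (i.+1%:R : F) i0 ('C(q, r)%:R : F) => x x0 b; field.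
have -> : q.-1 = q.-2.+1 by rewrite /q; lia.
by rewrite exprS mulrA mulfVK.
Qed.

(** The values [c_(i+p)] telescope to 0 and the [p - 1] ones add up to [-1]. *)
Lemma wsum0 : wsum 0 = -1.
Proof.
have := bintr0 F p p;
  rewrite /bintr (big_ord_pred (fun i => c (i.+1 + p)%N * 'C(i, 0)%:R));
  last by lia.
rewrite prednK ?bin0 ?mulr1; last by lia.
move=> /(canRL (addrK _)) e; rewrite /wsum /dualc.
under eq_bigr => i _ do rewrite expr0 mulr1.
have p1 : p.-1%:R = -1 :> F by rewrite -subn1 (pchar_natrB hp) //; lia.
rewrite big_split /= sumr_const card_ord p1.
have -> : \sum_(i < p.-1) c (i.+1 + p)%N = 0 :> F.
  rewrite (eq_bigr (fun i : 'I_p.-1 => c (i.+1 + p)%N * 'C(i, 0)%:R)) => [|i _];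
    last by rewrite bin0 mulr1.
  have t0 : tr6 p.+2 - tr6 (p + p).+2 - tr6 (p + p) = 0.
    rewrite (_ : (p + p).+2 = 2 + 2 * p)%N; last by lia.
    rewrite (_ : p.+2 = 2 + 1 * p)%N; last by lia.
    rewrite (_ : p + p = 0 + 2 * p)%N; last by lia.
    by rewrite !(tr6_shift p); have [->|->] := prime_mod6 p_pr p3.
  by rewrite e -!rmorphB /= t0.
by rewrite add0r.
Qed.

Lemma wsum_bernoulli m : (1 < m < p)%N ->
  reduces ((2%:R ^+ m - 1) * (3%:R ^+ m - 1) * bernoulli m)
    (- m%:R * wsum m.-1).
Proof.
move=> /andP[m1 mp].
(* The [+ 1] in [dualc] contributes a power sum of exponent below [p - 1], which is 0. *)
have -> : wsum m.-1 = \sum_(i < p) c (i + p)%N * i%:R ^+ m.-1.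
  have := power_sum_pchar hp p3 (m := m.-1); rewrite prednK; last by lia.
  move=> /(_ mp) e0; rewrite -[RHS]addr0 -[X in _ = _ + X]e0 -big_split /=.
  transitivity (\sum_(i < p) dualc F p i * i%:R ^+ m.-1).
    rewrite (big_ord_predl (fun i => dualc F p i * i%:R ^+ m.-1)) ?prime_gt0 //.
    rewrite expr0n (_ : (m.-1 == 0)%N = false); last by lia.
    by rewrite mulr0 add0r.
  by apply: eq_bigr => i _; rewrite /dualc mulrDl mul1r.
by apply: bernoulli_tr6_reduces; rewrite // mp; lia.
Qed.

Lemma wsum_odd m : odd m -> (1 < m < p)%N -> wsum m.-1 = 0.
Proof.
move=> mo hm; have := wsum_bernoulli hm; rewrite bernoulli_odd //;
  last by case/andP: hm.
rewrite mulr0 => /(reduces_inj (reduces_nat F 0)) /esym/eqP.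
rewrite mulf_eq0 oppr_eq0 => /orP[|/eqP //].
by rewrite (negPf (pchar_natf_neq0 hp _)) //; lia.
Qed.

(* The Bernoulli number of index [p - 1] is not [p]-integral, but [p] divides
   both [2^(p-1) - 1] and [3^(p-1) - 1]. *)
Lemma wsum_pred : wsum p.-2 = 0.
Proof.
have p1F : (1 < p.-1 < p)%N by lia.
have h : reduces ((2%:R ^+ p.-1 - 1) * (3%:R ^+ p.-1 - 1) * bernoulli p.-1)
  (0 : F).
  have fermat j : (1 < j < p)%N ->
    exists t : nat, j%:R ^+ p.-1 - 1 = p%:R * t%:R :> rat.
    move=> /andP[j1 jp]; have : (p %| j ^ p.-1 - 1)%N.
      rewrite (dvdn_pcharf hp) natrB ?expn_gt0 ?(ltnW j1) // natrX natr_exp_pred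
        ?subrr //.
      by apply: (pchar_natf_neq0 hp); lia.
    move=> /dvdnP[t et]; exists t; rewrite -natrX -natrM mulnC -et natrB //.
    by rewrite expn_gt0 ltnW.
  have [t2 ->] := fermat 2%N ltac:(lia); have [t3 ->] := fermat 3%N ltac:(lia).
  have hB := pint_bernoulli_mul hp (r := p.-1) ltac:(lia); rewrite prednK in hB;
    last by lia.
  rewrite (_ : _ * _ * _ = p%:R * (t2%:R * t3%:R * (p%:R * bernoulli p.-1)));
    last by ring.
  rewrite -[X in reduces _ X](mul0r
    (t2%:R * t3%:R * ratr (p%:R * bernoulli p.-1))) -(pcharf0 hp).
  apply: reducesM; first exact: reduces_nat.
  apply: reducesM; last exact: hB.
  by apply: reducesM; apply: reduces_nat.
have /eqP := reduces_inj (wsum_bernoulli p1F) h.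
rewrite mulf_eq0 oppr_eq0 => /orP[|/eqP //].
by rewrite (negPf (pchar_natf_neq0 hp _)) //; lia.
Qed.
End Assembly.

(** * The two parities of [n] *)

Section Final.
Variables (F : fieldType) (p : nat) (hp : p \in [pchar F]) (p3 : (3 < p)%N).
Variables (n : nat) (n2 : (2 <= n)%N) (np : (n + 1 < p)%N).

Let p_pr : prime p := pcharf_prime hp.
Local Notation pint x := (reduces x (ratr x : F)).
Local Notation W := (wsum F p).

Let F2 : 2%:R != 0 :> F. Proof. by apply: (pchar_natf_neq0 hp); lia. Qed.
Let F3 : 3%:R != 0 :> F. Proof. by apply: (pchar_natf_neq0 hp); lia. Qed.
Let F6 : 6%:R = 2%:R * 3%:R :> F. Proof. by rewrite -natrM. Qed.

Let ratr0 : ratr 0 = 0 :> F.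
Proof. exact/esym/reduces_ratr/(reduces_nat F 0). Qed.

Lemma wsum_ratr_bernoulli m : (1 < m < p.-1)%N ->
  - m%:R * W m.-1 = (2%:R ^+ m - 1) * (3%:R ^+ m - 1) * ratr (bernoulli m).
Proof.
move=> hm; have := @wsum_bernoulli F p hp p3 m ltac:(lia).
move=> h; apply: reduces_inj h _; apply: reducesM;
  last by apply: (pint_bernoulli hp); lia.
have r1 : reduces 1 (1 : F) := reduces_nat F 1.
by apply: reducesM; apply: reducesB => //; apply: reducesX; apply: reduces_nat.
Qed.

(** With [k = n + r - 2] and [m = p - n + 1 - r], [k + m = p - 1]; hence [j^k = j^(-m)] and
    [k + 1 = - m] in [F]. *)
Lemma even_term_reduces r : ~~ odd n -> (r < p - n + 1)%N ->
  reduces ('C(p - n + 1, r)%:R *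
         ((3%:R ^+ (n + r - 2) - 1) * (2%:R ^+ (n + r - 2) - 1)
            * bernoulli r * bernoulli (p - n - r + 1)
          / ((n + r - 1)%:R * 6%:R ^+ (n + r - 2))))
   ('C(p - n + 1, r)%:R * ratr (bernoulli r) * W (p - n + 1 - r).-1).
Proof.
move=> en rq.
have op : odd p by rewrite -(negbK (odd p)) -dvdn2 (dvdn_prime2 _ p_pr) //; lia.
rewrite -[X in reduces _ X]mulrA; apply: reducesM; first exact: reduces_nat.
(* Here [m = 1], outside the range of the Bernoulli formula for [W], but [B_(p-n) = 0]. *)
have [->|rpn] := eqVneq r (p - n)%N.
  rewrite (@bernoulli_odd (p - n)); [|lia|lia].
  by rewrite ratr0 !(mulr0, mul0r); apply: (reduces_nat F 0).
(* Here [m = p - 1]: one side vanishes through [3^0 - 1 = 0], the other through [wsum_pred]. *)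
have [k0|k0] := eqVneq (n + r - 2)%N 0%N.
  rewrite k0 expr0 subrr !mul0r (_ : p - n + 1 - r = p.-1)%N; last by lia.
  by rewrite (wsum_pred hp p3) mulr0; apply: (reduces_nat F 0).
set k := (n + r - 2)%N in k0 *; set m := (p - n + 1 - r)%N.
rewrite (_ : p - n - r + 1 = m)%N; last by rewrite /m; lia.
rewrite (_ : n + r - 1 = k.+1)%N; last by rewrite /k; lia.
have m0 : m%:R != 0 :> F by apply: (pchar_natf_neq0 hp); rewrite /m; lia.
have km : (k + m = p.-1)%N by rewrite /k /m; lia.
have inv j : j%:R != 0 :> F -> j%:R ^+ k = (j%:R ^+ m)^-1 :> F.
  move=> j0; have jm := expf_neq0 m j0; apply: (mulIf jm).
  by rewrite -exprD km mulVf // natr_exp_pred.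
have hm : (1 < m < p.-1)%N by rewrite /m; lia.
have -> : W m.-1 = (3%:R ^+ k - 1) * (2%:R ^+ k - 1) * ratr (bernoulli m) /
                   (k.+1%:R * 6%:R ^+ k).
  have e := wsum_ratr_bernoulli hm.
  have -> : k.+1%:R = - m%:R :> F by rewrite -(pchar_natrB hp); [congr _%:R|];
    lia.
  have -> : W m.-1 = (- m%:R * W m.-1) / - m%:R.
    by rewrite mulrAC divff ?mul1r // oppr_eq0.
  rewrite e F6 exprMn !inv //.
  have := expf_neq0 m F2; have := expf_neq0 m F3.
  move: (2%:R ^+ m : F) (3%:R ^+ m : F) (m%:R : F) m0 => x y z z0 y0 x0.
  by field; rewrite x0 y0 oppr_eq0.
rewrite [X in reduces _ X]mulrA [ratr (bernoulli r) * _]mulrA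
  [ratr (bernoulli r) * _]mulrC.
have rn j : reduces j%:R (j%:R : F) by apply: reduces_nat.
have r1 : reduces 1 (1 : F) := rn 1%N.
have rX j : reduces (j%:R ^+ k - 1) (j%:R ^+ k - 1 : F).
  by apply: reducesB => //; apply: reducesX.
apply: reducesM; last first.
  apply: reducesV.
    by apply: reducesM => //; apply: reducesX.
  rewrite mulf_neq0 ?expf_neq0 ?F6 ?mulf_neq0 //.
  by apply: (pchar_natf_neq0 hp); lia.
apply: reducesM; last by apply: (pint_bernoulli hp); lia.
by apply: reducesM; [apply: reducesM|apply: (pint_bernoulli hp); lia].
Qed.

Let nF : n.-1%:R != 0 :> F.
Proof. by apply: (pchar_natf_neq0 hp); lia. Qed.

Let q := (p - n.-1)%N.
Let qE : q%:R = - n.-1%:R :> F.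
Proof. by rewrite /q (pchar_natrB hp) //; lia. Qed.

(** Now [q - 1] is odd, so [W q.-2 = 0], and [(n-1)! / q = - (n-2)!] in [F]. *)
Lemma composition_sum_even : ~~ odd n ->
  exists y : F, reduces (composition_sum n p) y /\
   reduces (- ((n - 2)`!)%:R *
       \sum_(0 <= r < (p - n).+1)
         'C(p - n + 1, r)%:R *
         ((3%:R ^+ (n + r - 2) - 1) * (2%:R ^+ (n + r - 2) - 1)
            * bernoulli r * bernoulli (p - n - r + 1)
          / ((n + r - 1)%:R * 6%:R ^+ (n + r - 2)))) y.
Proof.
move=> en.
have op : odd p by rewrite -(negbK (odd p)) -dvdn2 (dvdn_prime2 _ p_pr) //; lia.
have := composition_sum_wsum hp p3 (n := n) ltac:(lia); rewrite /= -/q => h;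
  eexists; split; first exact: h.
rewrite (@wsum_odd F p hp p3 q.-1) ?addr0; [|rewrite /q; lia|rewrite /q; lia].
rewrite qE mulrA (_ : n.-1`!%:R / _ = - (n - 2)`!%:R); last first.
  have -> : (n.-1)`!%:R = n.-1%:R * (n - 2)`!%:R :> F.
    rewrite (_ : n.-1 = (n - 2).+1)%N; last by lia.
    by rewrite factS natrM.
  by rewrite invrN mulrN mulrAC divff ?mul1r.
apply: reducesM; first exact/reducesN/reduces_nat.
rewrite (_ : q = (p - n).+1); last by rewrite /q; lia.
rewrite big_mkord; apply: reduces_sum => r _.
by have := even_term_reduces en (r := r); rewrite addn1; apply.
Qed.

Lemma composition_sum_odd : odd n ->
  exists y : F, reduces (composition_sum n p) y /\
   reduces (- ((n - 1)`!)%:R *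
       (1 - (3%:R ^+ (n - 1) - 1) * (2%:R ^+ (n - 1) - 1)
            / (2%:R * n%:R * 6%:R ^+ (n - 1)))
       * bernoulli (p - n)) y.
Proof.
have q3 : (2 < q < p)%N by rewrite /q; lia.
have q_gt0 : (0 < q)%N by lia.
have qr r : (r < q)%N -> r != q.-1 -> (1 < q - r < p)%N by rewrite /q; lia.
have qq1 : (q - q.-1 = 1)%N by lia.
have q1 : (q.-1 = p - n)%N by rewrite /q; lia.
have q2 : ((p - n).-1 = q.-2)%N by rewrite -q1.
have hpn : (1 < p - n < p.-1)%N by lia.
have n_le_p : (n <= p)%N by lia.
have pn1 : (p - n + (n - 1) = p.-1)%N by lia.
have n0 : n%:R != 0 :> F by apply: (pchar_natf_neq0 hp); lia.
have q0 : q%:R != 0 :> F by apply: (pchar_natf_neq0 hp); lia.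
have rb : pint (bernoulli (p - n)) by apply: (pint_bernoulli hp); lia.
have oq : odd n -> odd q.
  have op : odd p by rewrite -(negbK (odd p)) -dvdn2 (dvdn_prime2 _ p_pr) //;
    lia.
  by rewrite /q; lia.
move=> on; have {}oq := oq on.
have := composition_sum_wsum hp p3 (n := n) ltac:(lia); rewrite /= -/q => h;
  eexists; split; first exact: h.
have rn j : reduces j%:R (j%:R : F) by apply: reduces_nat.
have r1 : reduces 1 (1 : F) := rn 1%N.
set b : F := ratr (bernoulli (p - n)).
set x : F := 2%:R ^+ (n - 1); set y : F := 3%:R ^+ (n - 1).
have x0 : x != 0 by apply: expf_neq0. have y0 : y != 0 by apply: expf_neq0.
(* As [q] is odd, odd [r > 1] have [B_r = 0], and even [r] have [W (q - r).-1 = 0] unless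
   [r = q - 1]. Only [r = 1] and [r = q - 1] survive. *)
have S1 : \sum_(r < q) 'C(q, r)%:R * ratr (bernoulli r) * W (q - r).-1
  = q%:R * (- W q.-2 / 2%:R - b) :> F.
  rewrite (bigD1 (Ordinal (ltn_trans (isT : 1 < 2)%N (proj1 (andP q3))))) //=.
  have qm : (q.-1 < q)%N by rewrite prednK.
  rewrite (bigD1 (Ordinal qm)) /=; last first.
    by rewrite -val_eqE /= -eqSS prednK // gtn_eqF //; case/andP: q3.
  rewrite big1 ?addr0 => [|[r /= rq]]; last first.
    rewrite -!val_eqE /= => /andP[r1' rq1].
    have [orr|err] := boolP (odd r).
      rewrite bernoulli_odd //; last by rewrite ltn_neqAle eq_sym r1' odd_gt0.
      by rewrite ratr0 mulr0 mul0r.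
    by rewrite (wsum_odd hp p3) ?mulr0 ?qr // oddB ?(ltnW rq) // oq (negPf err).
  rewrite bin1 subn1 qq1 /= (wsum0 hp p3) -[X in 'C(X, _)](prednK q_gt0) binSn
    prednK //.
  rewrite q1 -/b; have -> : ratr (bernoulli 1) = - 2%:R^-1 :> F.
    apply/esym/reduces_ratr; rewrite bernoulli_1.
    by apply/reducesN/reducesV.
  by ring.
have Wb : W q.-2 = (x - 1) * (y - 1) / (n%:R * x * y) * b.
  have := wsum_ratr_bernoulli hpn; rewrite q2 (pchar_natrB hp) ?opprK //.
  have inv j : j%:R != 0 :> F -> j%:R ^+ (p - n) = (j%:R ^+ (n - 1))^-1 :> F.
    move=> j0; apply: (mulIf (expf_neq0 (n - 1) j0)).
    by rewrite -exprD mulVf ?expf_neq0 // pn1 natr_exp_pred.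
  rewrite !inv // -/x -/y -/b => e; apply: (mulfI n0); rewrite e.
  by move: (n%:R : F) n0 => z z0; field; rewrite z0 x0 y0.
rewrite S1 mulKf // Wb -subn1.
set f : F := (n - 1)`!%:R.
(* The terms [- W q.-2 / 2] and [W q.-2] leave one half, whence the [2 n] in the denominator. *)
have -> : f * (- ((x - 1) * (y - 1) / (n%:R * x * y) * b) / 2%:R - b +
      (x - 1) * (y - 1) / (n%:R * x * y) * b) =
   - f * (1 - (y - 1) * (x - 1) / (2%:R * n%:R * (x * y))) * b.
  move: (n%:R : F) n0 => z z0.
  by field; rewrite z0 x0 y0 F2.
apply: (reducesM _ rb).
apply: reducesM; first exact: (reducesN (rn (n - 1)`!)).
have rX j : reduces (j%:R ^+ (n - 1) - 1) (j%:R ^+ (n - 1) - 1 : F)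
  by apply: reducesB => //; apply: reducesX.
apply: reducesB => //; apply: reducesM; first exact: reducesM.
have -> : x * y = 6%:R ^+ (n - 1) by rewrite F6 exprMn.
apply: reducesV.
  by apply: reducesM; [apply: reducesM|apply: reducesX].
by rewrite F6 !mulf_neq0 // expf_neq0 // mulf_neq0.
Qed.
End Final.

Theorem theorem1p3 (n p : nat) (hn : (2 <= n)%N) (hp : prime p)
    (hnp : (n + 1 < p)%N) :
  eqmod_rat p (composition_sum n p)
    (if ~~ odd n then
       - ((n - 2)`!)%:R *
       \sum_(0 <= r < (p - n).+1)
         'C(p - n + 1, r)%:R *
         ((3%:R ^+ (n + r - 2) - 1) * (2%:R ^+ (n + r - 2) - 1)
            * bernoulli r * bernoulli (p - n - r + 1)
          / ((n + r - 1)%:R * 6%:R ^+ (n + r - 2)))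
     else
       - ((n - 1)`!)%:R *
       (1 - (3%:R ^+ (n - 1) - 1) * (2%:R ^+ (n - 1) - 1)
            / (2%:R * n%:R * 6%:R ^+ (n - 1)))
       * bernoulli (p - n)).
Proof.
have p3 : (3 < p)%N by lia.
(* The field is taken to be the prime field of [p] elements. *)
have hF := pchar_Fp hp.
case: ifPn => [en|/negPn on].
  have [y [h1 h2]] := composition_sum_even hF p3 hn hnp en.
  exact: eqmod_rat_reduces hF h1 h2.
have [y [h1 h2]] := composition_sum_odd hF p3 hn hnp on.
exact: eqmod_rat_reduces hF h1 h2.
Qed.
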